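(* Let $T$ be any tree on $n\ge 1$ vertices. Then for all integers $k\ge 1$, \[\mathrm{Tmd}_k(T)\ge\left\lceil\frac{3n+k^2+k+\mathbb{1}_{k\equiv 1 \pmod 3}}{k^2+4k+3+\mathbb{1}_{k\equiv 1 \pmod 3}}\right\rceil.\]
   Context: For a graph $G=(V,E)$ let $d$ be the graph distance (with $d(x,x)=0$) and, for an integer $k\ge1$, $d_k(x,y)=\min\{d(x,y),k+1\}$. A vertex $s$ resolves a pair $x,y$ if $d_k(s,x)\ne d_k(s,y)$. A threshold-$k$ resolving set is a set $S\subseteq V$ such that every pair of distinct vertices $x,y\in V$ is resolved by some $s\in S$, and for every $x\in V$ there is some $s\in S$ with $d(s,x)\le k$. The threshold-$k$ metric dimension $\mathrm{Tmd}_k(G)$ is the minimum cardinality of a threshold-$k$ resolving set of $G$. $\mathbb{1}_{A}$ equals $1$ if $A$ holds and $0$ otherwise. *)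

(* Defs.v *)
From HB Require Import structures.
From mathcomp Require Import all_boot all_order all_algebra.

Set Implicit Arguments.
Unset Strict Implicit.
Unset Printing Implicit Defensive.

Section ThresholdMetricDimension.

Variables (V : finType) (e : rel V).

Definition has_walk (m : nat) (x y : V) : bool :=
  [exists p : m.-tuple V, path e x p && (last x p == y)].

Lemma connect_has_walk (x y : V) : connect e x y -> exists m, has_walk m x y.
Proof.
case/connectP=> p e_p ->; exists (size p).
by apply/existsP; exists (in_tuple p); rewrite e_p eqxx.
Qed.

(* [None] stands for an infinite distance. *)
Definition dist (x y : V) : option nat :=
  if decP (@idP (connect e x y)) is left xy
  then Some (ex_minn (connect_has_walk xy)) else None.

Definition tdist (k : nat) (x y : V) : nat :=
  if dist x y is Some m then minn m k.+1 else k.+1.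

Definition dist_le (k : nat) (x y : V) : bool :=
  if dist x y is Some m then m <= k else false.

Definition resolves (k : nat) (s x y : V) : bool :=
  tdist k s x != tdist k s y.

Definition threshold_resolving (k : nat) (S : {set V}) : bool :=
  [forall x, forall y, (x != y) ==> [exists s in S, resolves k s x y]]
  && [forall x, exists s in S, dist_le k s x].

(* The whole vertex set is always resolving (see [threshold_resolvingT]), so
   this is a genuine minimum. *)
Definition Tmd (k : nat) : nat :=
  #|[arg min_(S < [set: V] | threshold_resolving k S) #|S| ]|.

Definition tree : Prop :=
  [/\ symmetric e,
      irreflexive e,
      forall x y, connect e x y
    & forall c : seq V, 2 < size c -> ~ ucycle e c].

Lemma dist_eq0 (x y : V) : (dist x y == Some 0) = (x == y).
Proof.
rewrite /dist; case: decP => [xy | nxy]; last first.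
  by case: (x =P y) nxy => // ->; case; rewrite connect0.
case: ex_minnP => m /existsP[p /andP[e_p /eqP last_p]] min_m.
apply/eqP/eqP=> [[m0] | eq_xy].
  by move: p e_p last_p {min_m}; rewrite m0 => p; rewrite tuple0.
suff: m <= 0 by rewrite leqn0 => /eqP ->.
by apply: min_m; apply/existsP; exists [tuple]; rewrite /= eq_xy.
Qed.

Lemma threshold_resolvingT (k : nat) : threshold_resolving k [set: V].
Proof.
have d0 x : dist x x = Some 0 by apply/eqP; rewrite dist_eq0.
apply/andP; split; apply/forallP=> x; last first.
  by apply/existsP; exists x; rewrite inE /dist_le d0.
apply/forallP=> y; apply/implyP=> neq_xy; apply/existsP; exists x.
rewrite inE /resolves /tdist d0 min0n /=.
by move: neq_xy; rewrite -dist_eq0; case: (dist x y) => [[|m]|] // _; rewrite minnSS.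
Qed.

Lemma TmdP (k : nat) :
  (exists2 S : {set V}, threshold_resolving k S & #|S| = Tmd k)
  /\ (forall S : {set V}, threshold_resolving k S -> Tmd k <= #|S|).
Proof.
rewrite /Tmd; case: arg_minnP => [|S resS minS].
  exact: threshold_resolvingT.
by split; first exists S.
Qed.

End ThresholdMetricDimension.

(* Main.v *)
(* Let S be a threshold-k resolving set of size m. Send each vertex v to the
   vertex b farthest from v that lies on all paths from v to the sensors
   measuring v. The pair (b, d(v,b)) determines the truncated distances of v,
   hence v. At most k+1 vertices are sent to a given sensor. If b is not a
   sensor, then v is measured by sensors in two different directions from b;
   cutting the tree at b, the two nearest sensors x, y in different directions
   realise the minimal distance across a cut of S, so some edge {p, q} of a
   minimum spanning tree of the metric space S has b on its path, with p and q
   at the same distances from b as x and y. With L = d(p,q) and a = d(p,b),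
   there are at most k+1-max(a,L-a) values of d(v,b), and the sum of these
   bounds over 0 < a < L is at most (k^2+k+[k = 1 mod 3])/3 whatever L is.
   Hence n <= m(k+1) + (m-1)(k^2+k+[k = 1 mod 3])/3. *)
Require Import Defs.
From mathcomp Require Import all_boot all_order all_algebra.
From mathcomp Require Import zify.

Set Implicit Arguments.
Unset Strict Implicit.
Unset Printing Implicit Defensive.

(** * Arithmetic of the capacity of a pair of sensors *)

Definition pair_capacity (k L : nat) : nat :=
  \sum_(1 <= a < L) (k.+1 - maxn a (L - a)).

Lemma pair_capacity0 (L : nat) : pair_capacity 0 L = 0.
Proof.
rewrite /pair_capacity big_nat big1 // => a /andP[a_gt0 _]; lia.
Qed.

(** The two extreme terms both equal [k.+1 - L]; shifting the index in the others gives the sum for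
    [k] and [L]. *)
Lemma pair_capacitySS (k L : nat) : 0 < L ->
  pair_capacity k.+1 L.+2 = pair_capacity k L + 2 * (k.+1 - L).
Proof.
case: L => // L _; rewrite /pair_capacity.
rewrite big_nat_recl // big_nat_recr // [in RHS]big_add1 /=.
have -> : \sum_(1 <= i < L.+1) (k.+2 - maxn i.+1 (L.+3 - i.+1))
        = \sum_(0 <= i < L) (k.+1 - maxn i.+1 (L.+1 - i.+1)).
  rewrite big_add1 /=; apply: eq_big_nat => i i_lt; lia.
lia.
Qed.

(** Terms drop by one at each step away from the middle, and each half has [q] nonzero ones. The
    induction raises [k] and [l] together, so [k - l] stays fixed. *)
Lemma pair_capacity_odd (k l : nat) (q := minn l (k - l)) :
  pair_capacity k l.*2.+1 + q * q = 2 * q * (k - l) + q.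
Proof.
rewrite {}/q; elim: l k => [|l IHl] [|k].
- by rewrite pair_capacity0 min0n.
- by rewrite /pair_capacity big_nil min0n.
- by rewrite pair_capacity0 sub0n minn0.
rewrite doubleS pair_capacitySS // subSS.
have [lt_kl|le_lk] := ltnP (k - l) l.+1.
  have := IHl k; rewrite (minn_idPr _); nia.
have := IHl k; rewrite (minn_idPl _); nia.
Qed.

Lemma pair_capacity_even (k l : nat) (q := minn l (k - l)) :
  pair_capacity k l.*2.+2 + q * q + q = (2 * q + 1) * (k - l).
Proof.
rewrite {}/q; elim: l k => [|l IHl] [|k].
- by rewrite pair_capacity0.
- rewrite /pair_capacity big_nat1 min0n; lia.
- by rewrite pair_capacity0 sub0n minn0.
rewrite doubleS pair_capacitySS // subSS.
have [lt_kl|le_lk] := ltnP (k - l) l.+1.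
  have := IHl k; rewrite (minn_idPr _); nia.
have := IHl k; rewrite (minn_idPl _); nia.
Qed.

(** Since [q <= l], replacing [k - l] by [k - q] leaves a quadratic inequality in [k] and [q]. Only
    even lengths can need the extra 1. *)
Lemma pair_capacity_le (k L : nat) :
  3 * pair_capacity k L <= k ^ 2 + k + (k == 1 %[mod 3]).
Proof.
case: L => [|L]; first by rewrite /pair_capacity big_geq.
rewrite -(odd_double_half L) expnS expn1; set l := L./2.
case: odd; rewrite ?add1n ?add0n.
  have := pair_capacity_even k l; set F := pair_capacity _ _.
  set q := minn _ _ => FE.
  have [l_le|l_gt] := leqP l k; last first.
    have c0 : k - l = 0 by lia.
    move: FE; rewrite c0; lia.
  (* With k = q + r, the slack is at least the square of r - (2q + 1). *)
  have F_le : 3 * F <= k * k + k + 1.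
    have c_le : k - l <= k - q by lia.
    have q_le : q <= k by lia.
    have : F + q * q + q <= (2 * q + 1) * (k - q).
      by rewrite FE leq_mul2l c_le orbT.
    clear FE c_le; move: q_le; clearbody F q.
    move=> /subnKC; move: (k - q) => r <-.
    have [/subnKC|/ltnW/subnKC] := leqP r (2 * q + 1); move: (_ - _) => t E; nia.
  case: eqP => [_|k_mod]; first by [].
  (* For [k] not 1 modulo 3, [k * k + k + 1] is 1 modulo 3, so it is not a multiple of 3. *)
  rewrite addn0; suff : 3 * F != k * k + k + 1 by lia.
  have [j [|]] : exists j, k = 3 * j \/ k = 3 * j + 2 by exists (k %/ 3); lia.
    by move=> k_eq; apply/eqP; clear FE F_le; rewrite k_eq; lia.
  by move=> k_eq; apply/eqP; clear FE F_le; rewrite k_eq; lia.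
have := pair_capacity_odd k l; set F := pair_capacity _ _.
set q := minn _ _ => FE.
have [l_le|l_gt] := leqP l k; last first.
  have c0 : k - l = 0 by lia.
  move: FE; rewrite c0; lia.
have c_le : k - l <= k - q by lia.
have q_le : q <= k by lia.
have : F + q * q <= 2 * q * (k - q) + q by rewrite FE leq_add2r leq_mul2l c_le orbT.
clear FE.
(* The slack is at least [(k - 3q)(k - 3q + 1)], a product of consecutive integers. *)
have [le3|gt3] := leqP (3 * q) k; nia.
Qed.

(** * Minimum spanning trees *)

(* E is the edge list of a minimum spanning tree of S. The induction is
   Kruskal's algorithm: l lists the pairs of S by decreasing weight, and c
   labels the components of the forest E. *)
Lemma kruskal (T : finType) (S : {set T}) (w : T -> T -> nat) :
  (forall x y, w x y = w y x) -> S != set0 ->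
  exists2 E : seq (T * T), size E < #|S| &
    forall (X : pred T) x y, x \in S -> y \in S -> X x -> ~~ X y ->
      exists2 p, p \in E \/ (p.2, p.1) \in E &
        [/\ p.1 \in S, p.2 \in S, X p.1, ~~ X p.2 & w p.1 p.2 <= w x y].
Proof.
move=> w_sym S_n0.
pose le_w := [rel p q : T * T | w q.1 q.2 <= w p.1 p.2].
have le_w_tr : transitive le_w by move=> p q r /= pq rp; apply: leq_trans rp pq.
have le_w_tot : total le_w by move=> p q /=; apply: leq_total.
pose crosses (X : pred T) (p : T * T) := X p.1 != X p.2.
(* Connectedness in [E] is phrased through cuts: any cut separating two points with equal labels is
   crossed by an edge of [E]. *)
suff kr l : sorted le_w l -> {in l, forall p, (p.1 \in S) && (p.2 \in S)} ->
    exists E : seq (T * T), exists c : T -> T,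
      [/\ size E + #|c @: S| <= #|S|,
          {subset E <= l},
          {in l, forall p, c p.1 = c p.2},
          forall X x y, c x = c y -> X x != X y ->
            exists2 p, p \in E & crosses X p
        & forall X, {in l, forall q, crosses X q ->
            exists2 p, p \in E & crosses X p && (w p.1 p.2 <= w q.1 q.2)}].
  have := kr _ (sort_sorted le_w_tot (enum (setX S S))).
  case=> [p|E [c [szE subE _ _ cutE]]].
    by rewrite mem_sort mem_enum inE.
  exists E.
    have : 0 < #|c @: S| by rewrite card_gt0 imset_eq0.
    by lia.
  move=> X x y Sx Sy Xx Xy.
  have [||p Ep /andP[Xp wp]] := cutE X (x, y).
  - by rewrite mem_sort mem_enum inE /= Sx Sy.
  - by rewrite /crosses /= Xx (negbTE Xy).
  have /andP[S1 S2] : (p.1 \in S) && (p.2 \in S).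
    by have := subE _ Ep; rewrite mem_sort mem_enum inE.
  move: Xp; rewrite /crosses; case X1: (X p.1); case X2: (X p.2) => // _.
    by exists p; [left | split=> //; rewrite X2].
  exists (p.2, p.1); first by right; rewrite /= -surjective_pairing.
  by split=> //=; rewrite ?X1 // w_sym.
elim: l => [|[u v] l IHl] /=.
  move=> _ _; exists [::], id; split=> //; first by rewrite imset_id.
  by move=> X x y ->; rewrite eqxx.
move=> sorted_l memS.
have /allP min_uv := order_path_min le_w_tr sorted_l.
have /andP[Su Sv] := memS (u, v) (mem_head _ _).
have [|p lp|E [c [szE subE cl conE cutE]]] := IHl.
- exact: path_sorted sorted_l.
- by apply: memS; rewrite inE lp orbT.
(* With equal labels the pair is skipped: [E] already crosses every cut between [u] and [v], using
   entries of the tail, which are no heavier. *)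
have [cuv|cuv] := eqVneq (c u) (c v).
  exists E, c; split=> //.
  - by move=> p /subE lp; rewrite inE lp orbT.
  - by move=> p; rewrite inE => /predU1P[->|/cl].
  move=> X q; rewrite inE => /predU1P[->|/cutE]; last exact.
  move=> Xuv; have [p Ep Xp] := conE X _ _ cuv Xuv.
  by exists p; rewrite // Xp; apply: min_uv (subE _ Ep).
pose c' x := if c x == c v then c u else c x.
exists ((u, v) :: E), c'.
have conE' X x y : c' x = c' y -> X x != X y ->
    exists2 p, p \in (u, v) :: E & crosses X p.
  have old a b : c a = c b -> X a != X b ->
      exists2 p, p \in (u, v) :: E & crosses X p.
    by move=> ab /(conE _ _ _ ab)[p Ep Xp]; exists p; rewrite // inE Ep orbT.
  have [Xuv|] := eqVneq (X u) (X v); last by exists (u, v); rewrite ?mem_head.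
  rewrite /c'; case: eqP => [xv|_]; case: eqP => [yv|_]; last exact: old.
  - by move=> _; apply: old; rewrite xv yv.
  - move=> uy Xxy; have [Xxv|] := eqVneq (X x) (X v); last exact: old.
    by apply: (old u y) => //; rewrite Xuv -Xxv.
  - move=> xu Xxy; have [Xyv|] := eqVneq (X y) (X v); last exact: old.
    by apply: (old x u) => //; rewrite Xuv -Xyv.
split=> //.
(* The merger removes the label [c v], which pays for the new edge. *)
- have /subset_leq_card : c' @: S \subset (c @: S) :\ c v.
    apply/subsetP=> _ /imsetP[x Sx ->]; rewrite !inE /c'.
    by have [xv|xv] := eqVneq (c x) (c v); rewrite ?cuv ?xv imset_f.
  by have := cardsD1 (c v) (c @: S); rewrite imset_f //=; lia.
- by move=> p; rewrite !inE => /predU1P[->|/subE ->]; rewrite ?eqxx ?orbT.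
- move=> p; rewrite inE => /predU1P[->|/cl cp] /=; rewrite /c' /=.
    by rewrite eqxx (negbTE cuv).
  by rewrite cp.
move=> X q; rewrite inE => /predU1P[->|lq] Xq.
  by exists (u, v); rewrite ?mem_head // Xq /=.
have [p Ep Xp] := cutE X q lq Xq.
by exists p; rewrite // inE Ep orbT.
Qed.

(** * Distances and branches in a tree *)

Section TreeMetric.

Variables (V : finType) (e : rel V).
Hypothesis tree_e : tree e.

Definition ndist (x y : V) : nat := odflt 0 (dist e x y).

Definition between (x b y : V) : bool := ndist x b + ndist b y == ndist x y.

(** Names the branch at [x] that contains [y]; in a tree the default is reached only for [x = y]. *)
Definition toward (x y : V) : V :=
  odflt x [pick z | e x z && ((ndist z y).+1 == ndist x y)].

Lemma ndist_spec (x y : V) :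
  [/\ dist e x y = Some (ndist x y), has_walk e (ndist x y) x y
    & forall m, has_walk e m x y -> ndist x y <= m].
Proof.
have [_ _ conn _] := tree_e; rewrite /ndist /dist.
by case: decP => [xy|[]] //; case: ex_minnP.
Qed.

Lemma ndist_le_path (x : V) (p : seq V) :
  path e x p -> ndist x (last x p) <= size p.
Proof.
move=> e_p; have [_ _] := ndist_spec x (last x p); apply.
by apply/existsP; exists (in_tuple p); rewrite e_p eqxx.
Qed.

Lemma geodesic (x y : V) :
  exists p, [/\ path e x p, last x p = y & size p = ndist x y].
Proof.
have [_ /existsP[p /andP[e_p /eqP last_p]] _] := ndist_spec x y.
by exists p; rewrite size_tuple.
Qed.

Lemma ndist_eq0 (x y : V) : (ndist x y == 0) = (x == y).
Proof. by rewrite -(dist_eq0 e); have [-> _ _] := ndist_spec x y. Qed.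

Lemma ndistxx (x : V) : ndist x x = 0.
Proof. by apply/eqP; rewrite ndist_eq0. Qed.

Lemma ndist_triangle (y x z : V) : ndist x z <= ndist x y + ndist y z.
Proof.
have [p [e_p last_p <-]] := geodesic x y; have [q [e_q last_q <-]] := geodesic y z.
have := @ndist_le_path x (p ++ q).
by rewrite cat_path last_cat last_p last_q e_p e_q size_cat; apply.
Qed.

Lemma ndistC (x y : V) : ndist x y = ndist y x.
Proof.
have [e_sym _ _ _] := tree_e.
suff le_d a b : ndist a b <= ndist b a by apply/eqP; rewrite eqn_leq !le_d.
have [p [e_p last_p sz_p]] := geodesic b a.
have e_rev : path e a (rev (belast b p)).
  by rewrite -{1}last_p rev_path (eq_path (e' := e)) // => u v; apply: e_sym.
have := ndist_le_path e_rev; rewrite size_rev size_belast sz_p.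
suff -> : last a (rev (belast b p)) = b by [].
by case: p last_p {e_p sz_p e_rev} => [|c q] /= last_p; rewrite ?rev_cons ?last_rcons.
Qed.

Lemma betweenC (x b y : V) : between x b y = between y b x.
Proof. by rewrite /between addnC (ndistC b y) (ndistC x b) (ndistC x y). Qed.

Lemma toward_spec (x y : V) :
  x != y -> e x (toward x y) /\ (ndist (toward x y) y).+1 = ndist x y.
Proof.
move=> neq_xy; rewrite /toward; case: pickP => [z /andP[exz /eqP]|no_z] //=.
have [[|z p] [/= e_p last_p sz_p]] := geodesic x y.
  by rewrite last_p eqxx in neq_xy.
case/andP: e_p => exz e_p; have /negP[] := negbT (no_z z).
rewrite exz /= eqn_leq; apply/andP; split.
  by rewrite -sz_p ltnS -last_p ndist_le_path.
apply: leq_trans (ndist_triangle z x y) _; rewrite -add1n leq_add2r.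
by have := @ndist_le_path x [:: z]; rewrite /= exz; apply.
Qed.

Lemma ndist_edge (x y : V) : e x y -> ndist x y <= 1.
Proof. by move=> exy; have := @ndist_le_path x [:: y]; rewrite /= exy; apply. Qed.

Definition avoiding (b : V) : rel V :=
  [rel x y | [&& e x y, x != b & y != b]].

(** Following [toward] from [x] to [y] never meets [b]: otherwise [b] would lie on a geodesic. *)
Lemma connect_avoiding (b x y : V) :
  ~~ between x b y -> connect (avoiding b) x y.
Proof.
move d_xy: (ndist x y) => m; elim: m x d_xy => [|m IHm] x d_xy.
  by move/eqP: d_xy; rewrite ndist_eq0 => /eqP -> _; apply: connect0.
move=> nb; have neq_xy : x != y by rewrite -ndist_eq0 d_xy.
have [e_xz d_zy] := toward_spec neq_xy.
have not_b a : ~~ between a b y -> a != b.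
  by apply: contraNneq => ->; rewrite /between ndistxx.
have nbz : ~~ between (toward x y) b y.
  apply: contra nb; rewrite /between => /eqP bz.
  have := ndist_triangle (toward x y) x b; have := ndist_edge e_xz.
  have := ndist_triangle b x y; lia.
apply: connect_trans (IHm _ _ nbz); last by lia.
by apply: connect1; rewrite /avoiding /= e_xz !not_b.
Qed.

(** If [u] and [v] differed, a simple path between them off [b] would close up through [b] to a
    cycle. This is where acyclicity enters. *)
Lemma avoiding_neighbors (b u v : V) :
  e b u -> e b v -> connect (avoiding b) u v -> u = v.
Proof.
have [e_sym e_irr _ acyclic] := tree_e.
move=> ebu ebv /connectP[p0 p0_path v_last].
case/shortenP: p0_path v_last => p p_path uniq_p _ v_last.
case: p => [|w p] in p_path uniq_p v_last *; first by rewrite v_last.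
case: (acyclic [:: b, u, w & p]) => //; apply/andP; split.
  rewrite (cycle_path b) /= -[last w p]/(last u (w :: p)) -v_last.
  rewrite e_sym ebv ebu /=.
  by apply: (sub_path (e := avoiding b)) p_path => x y /and3P[].
rewrite cons_uniq uniq_p andbT inE negb_or.
rewrite (contraTneq _ ebu) => [/=|->]; last by rewrite e_irr.
elim: (w :: p) u p_path {uniq_p ebu v_last} => //= x q IHq u.
by case/andP=> /and3P[_ _ xb] /IHq; rewrite inE negb_or eq_sym xb.
Qed.

Lemma between_toward (b x y : V) :
  x != b -> y != b -> toward b x != toward b y -> between x b y.
Proof.
have [e_sym _ _ _] := tree_e.
rewrite !(eq_sym _ b) => bx by_; apply: contraNT => nb.
have avoid_sym : connect_sym (avoiding b).
  apply: sym_connect_sym => u v; rewrite /avoiding /= e_sym.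
  by congr (_ && _); apply: andbC.
have step z : b != z -> e b (toward b z) /\ connect (avoiding b) (toward b z) z.
  move=> bz; have [ez dz] := toward_spec bz; split=> //.
  by apply: connect_avoiding; rewrite /between; lia.
have [ex cx] := step _ bx; have [ey cy] := step _ by_.
apply/eqP/(avoiding_neighbors ex ey)/(connect_trans cx).
apply: connect_trans (connect_avoiding nb) _.
by rewrite avoid_sym.
Qed.

(** If [b] and [c] differed, [x] and [y] would both lie in the branch at [b] containing [c], and
    bypassing [b] through its neighbor there would beat the geodesic. *)
Lemma between_inj (x y b c : V) :
  between x b y -> between x c y -> ndist x b = ndist x c -> b = c.
Proof.
move=> /eqP bxy /eqP cxy bc.
have [-> //|neq_bc] := eqVneq b c.
have side z : ndist z b = ndist z c -> z != b /\ toward b z = toward b c.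
  move=> zbc; have zb : z != b.
    apply: contraNneq neq_bc => zb; rewrite -ndist_eq0 -{1}zb -zbc zb ndistxx //.
  split=> //; apply/eqP/negPn/negP => nz; move: (neq_bc); rewrite eq_sym => neq_cb.
  have := between_toward zb neq_cb nz; rewrite /between zbc.
  by have := ndist_eq0 b c; lia.
have [xb nx] := side x bc.
have [|yb ny] := side y; first by rewrite (ndistC y b) (ndistC y c); lia.
have bx : b != x by rewrite eq_sym.
have [_ dx] := toward_spec bx.
have yb' : b != y by rewrite eq_sym.
have [_ dy] := toward_spec yb'.
have := ndist_triangle (toward b c) x y.
by rewrite -bxy [ndist x b]ndistC -dx -dy nx ny ndistC; lia.
Qed.

End TreeMetric.

(** * Counting by covers and by injections *)

Lemma card_le_sum_cover (V : finType) (I : eqType) (r : seq I) (A : {set V})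
    (B : I -> {set V}) :
  (forall v, v \in A -> exists2 i, i \in r & v \in B i) ->
  #|A| <= \sum_(i <- r) #|B i|.
Proof.
elim: r A => [|i r IHr] A covA.
  rewrite big_nil leqn0 cards_eq0; apply/eqP/setP=> v; rewrite inE.
  by apply/negP=> /covA[].
rewrite big_cons -(cardsID (B i) A) leq_add ?subset_leq_card ?subsetIr //.
apply: IHr => v; rewrite inE => /andP[nBv /covA[j]].
by rewrite inE => /predU1P[->|]; [rewrite (negbTE nBv) | exists j].
Qed.

Lemma card_le_inj_nat (V : finType) (A : {set V}) (f : V -> nat) (N : nat) :
  {in A &, injective f} -> (forall v, v \in A -> f v < N) -> #|A| <= N.
Proof.
move=> f_inj f_lt; rewrite cardE -(size_map f) -[leqRHS](size_iota 0 N).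
apply: uniq_leq_size => [|_ /mapP[v Av ->]].
  by rewrite map_inj_in_uniq ?enum_uniq // => u v; rewrite !mem_enum; apply: f_inj.
by rewrite mem_iota add0n f_lt // -mem_enum.
Qed.

(** * Charging vertices to sensors and to pairs of sensors *)

Section Counting.

Variables (V : finType) (e : rel V).
Hypothesis tree_e : tree e.
Variables (k : nat) (S : {set V}).
Hypothesis resolving_S : threshold_resolving e k S.

Local Notation d := (ndist e).

Definition meets_routes (v b : V) : bool :=
  [forall t in S, (d t v <= k) ==> between e v b t].

Definition gate (v : V) : V := [arg max_(b > v | meets_routes v b) d v b].

Lemma gateP (v : V) :
  (forall t, t \in S -> d t v <= k -> between e v (gate v) t)
  /\ (forall b, (forall t, t \in S -> d t v <= k -> between e v b t) ->
        d v b <= d v (gate v)).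
Proof.
have meetsP b : reflect (forall t, t \in S -> d t v <= k -> between e v b t)
                        (meets_routes v b).
  apply: (iffP forall_inP) => bt t St; first by move=> tv; have /implyP := bt t St; apply.
  by apply/implyP; apply: bt.
rewrite /gate; case: arg_maxnP => [|b /meetsP gb max_b].
  by apply/meetsP=> t _ _; rewrite /between ndistxx.
by split=> // c /meetsP; apply: max_b.
Qed.

(** A sensor within [k] of either vertex sees it through the common gate, so it is at most as far
    from the other; by symmetry no sensor resolves the two. *)
Lemma gate_inj (u v : V) :
  gate u = gate v -> d u (gate u) = d v (gate v) -> u = v.
Proof.
move=> gate_uv d_uv; apply/eqP/negPn/negP => neq_uv.
have /andP[/forallP/(_ u)/forallP/(_ v)/implyP/(_ neq_uv)] := resolving_S.
case/exists_inP=> t St; rewrite /resolves /tdist.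
have [-> _ _] := ndist_spec tree_e t u; have [-> _ _] := ndist_spec tree_e t v.
have le_d x y : gate x = gate y -> d x (gate x) = d y (gate y) ->
    d t x <= k -> d t y <= d t x.
  move=> gxy dxy tx; have [/(_ t St tx)/eqP gx _] := gateP x.
  rewrite ![d t _](ndistC tree_e) -gx dxy gxy.
  exact: ndist_triangle.
have := le_d u v gate_uv d_uv; have := le_d v u (esym gate_uv) (esym d_uv).
lia.
Qed.

Lemma gate_height (v : V) : d v (gate v) <= k.
Proof.
have /andP[_ /forallP/(_ v)/exists_inP[t St]] := resolving_S.
rewrite /dist_le; have [-> _ _] := ndist_spec tree_e t v => tv.
have [/(_ t St tv)/eqP gx _] := gateP v.
by move: tv; rewrite ndistC // -gx; lia.
Qed.

(** Were all sensors measuring [v] in one branch at the gate, the first vertex of that branch would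
    be a farther common point of the routes. *)
Lemma gate_branches (v : V) : gate v \notin S ->
  exists t t', [/\ t \in S, t' \in S, d t v <= k, d t' v <= k
    & toward e (gate v) t != toward e (gate v) t'].
Proof.
move=> gS; set b := gate v in gS *; have [gb max_b] := gateP v; rewrite -/b in gb max_b.
have /andP[_ /forallP/(_ v)/exists_inP[t St]] := resolving_S.
rewrite /dist_le; have [-> _ _] := ndist_spec tree_e t v => tv.
have nb s : s \in S -> b != s by apply: contraTneq => <-.
have [/exists_inP[t' /andP[St' t'v] nt]|] :=
  boolP [exists t' in [pred t' in S | d t' v <= k], toward e b t != toward e b t'].
  by exists t, t'.
rewrite negb_exists_in => /forall_inP same.
set u := toward e b t.
have u_closer t' : t' \in S -> d t' v <= k -> e b u /\ (d u t').+1 = d b t'.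
  move=> St' t'v; rewrite /u; have -> : toward e b t = toward e b t'.
    by apply/eqP/negPn/same; rewrite inE St'.
  by apply: toward_spec => //; apply: nb.
have : d v u <= d v b.
  apply: max_b => t' St' t'v; have [ebu du] := u_closer t' St' t'v.
  have := gb t' St' t'v; rewrite /between => /eqP gt'.
  have := ndist_triangle tree_e u v t'; have := ndist_triangle tree_e b v u.
  have := ndist_edge tree_e ebu; rewrite /between; lia.
have [_ du] := u_closer t St tv; have /eqP gt := gb t St tv.
by have := ndist_triangle tree_e u v t; lia.
Qed.

(** [X] is the branch at [b] of a nearest sensor [x], and [y] is a nearest sensor outside it. Pairs
    across [X] are joined through [b], so one no longer than [x], [y] has the same two distances to
    [b]. *)
Lemma gate_cut (v : V) (b := gate v) : b \notin S ->
  exists X : pred V, exists x y, [/\ x \in S, y \in S, X x, ~~ X y &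
    forall p q, p \in S -> q \in S -> X p -> ~~ X q -> d p q <= d x y ->
      [/\ between e p b q, d v b + d b p <= k & d v b + d b q <= k]].
Proof.
move=> gS; have nb s : s \in S -> s != b by apply: contraTneq => ->.
have [t [t' [St St' tv t'v ntt']]] := gate_branches gS.
have [gb _] := gateP v; rewrite -/b in gb ntt'.
case: (arg_minnP (d b) St) => x Sx min_x.
pose X := [pred z | toward e b z == toward e b x].
(* [x] and [y] are chosen without regard to [v]; the sensor [y0], measuring [v] from outside [X],
   bounds both distances. *)
have [y0 /andP[Sy0 Xy0] y0v] : exists2 y0, (y0 \in S) && ~~ X y0 & d y0 v <= k.
  have [Xt|nXt] := boolP (X t); last by exists t; rewrite ?St.
  exists t'; rewrite ?St' //; apply: contra ntt' => /eqP /= ->; exact: Xt.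
pose P := [pred z | (z \in S) && ~~ X z].
have Py0 : P y0 by rewrite /= Sy0.
case: (arg_minnP (P := P) (d b) Py0) => y /andP[Sy nXy] min_y.
exists X, x, y; split=> // [|p q Sp Sq Xp nXq le_pq]; first by rewrite /= eqxx.
have btw s z : s \in S -> z \in S -> X s -> ~~ X z -> between e s b z.
  move=> Ss Sz /eqP Xs nXz; apply: between_toward; rewrite ?nb // Xs eq_sym //.
have pq := btw p q Sp Sq Xp nXq; split=> //.
all: move/eqP: pq; have /eqP := btw x y Sx Sy (eqxx _) nXy.
all: have /eqP := gb y0 Sy0 y0v; move: y0v; rewrite (ndistC tree_e y0).
all: have := min_y y0 Py0; have := min_x y0 Sy0; have := min_x p Sp.
all: have := min_y q; rewrite [P q]/= Sq nXq => /(_ isT).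
all: by rewrite !(ndistC tree_e _ b); clear -le_pq; lia.
Qed.

Definition pair_block (p q : V) : {set V} :=
  [set v | [&& gate v != p, gate v != q, between e p (gate v) q,
               d v (gate v) + d (gate v) p <= k & d v (gate v) + d (gate v) q <= k]].

(** The distance from [p] determines the gate on the geodesic, and then the height determines the
    vertex. *)
Lemma card_pair_block (p q : V) : #|pair_block p q| <= pair_capacity k (d p q).
Proof.
pose level a := [set v in pair_block p q | d p (gate v) == a].
apply: leq_trans (_ : \sum_(1 <= a < d p q) #|level a| <= _).
  apply: card_le_sum_cover => v Bv; exists (d p (gate v)); last by rewrite inE Bv eqxx.
  move: Bv; rewrite inE mem_index_iota => /and5P[bp bq /eqP pq _ _].
  have := ndist_eq0 tree_e p (gate v); have := ndist_eq0 tree_e (gate v) q.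
  by rewrite (eq_sym p) (negbTE bp) (negbTE bq); lia.
apply: leq_sum => a _.
apply: (@card_le_inj_nat _ _ (fun v => d v (gate v))) => [u v|v]; rewrite !inE.
  move=> /andP[/and5P[_ _ u_pq _ _] /eqP ua] /andP[/and5P[_ _ v_pq _ _] /eqP va].
  by apply: gate_inj; apply: (between_inj tree_e u_pq v_pq); rewrite ua.
case/andP=> /and5P[_ _ /eqP pq vp vq] /eqP pa.
by move: vp vq; rewrite (ndistC tree_e _ p) pa; lia.
Qed.

Lemma card_gate_in : #|[set v | gate v \in S]| <= #|S| * k.+1.
Proof.
rewrite -sum_nat_const -big_enum /=.
apply: leq_trans (_ : \sum_(s <- enum S) #|[set v | gate v == s]| <= _).
  apply: card_le_sum_cover => v; rewrite inE => Sv.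
  by exists (gate v); rewrite ?mem_enum ?inE.
apply: leq_sum => s _.
apply: (@card_le_inj_nat _ _ (fun v => d v (gate v))) => [u v|v]; rewrite !inE.
  by move=> /eqP us /eqP vs; apply: gate_inj; rewrite us.
by rewrite ltnS gate_height.
Qed.

Lemma card_tree_le (n := #|V|) (c := k ^ 2 + k + (k == 1 %[mod 3])) :
  0 < n -> 3 * n + c <= #|S| * (k ^ 2 + 4 * k + 3 + (k == 1 %[mod 3])).
Proof.
move=> /card_gt0P[v0 _].
have S_n0 : S != set0.
  have /andP[_ /forallP/(_ v0)/exists_inP[t St _]] := resolving_S.
  by apply/set0Pn; exists t.
have [E szE cutE] := kruskal (ndistC tree_e) S_n0.
have le_out : #|[set v | gate v \notin S]| <= \sum_(p <- E) #|pair_block p.1 p.2|.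
  apply: card_le_sum_cover => v; rewrite inE => gS.
  have [X [x [y [Sx Sy Xx Xy far]]]] := gate_cut gS.
  have [p Ep [Sp1 Sp2 Xp1 Xp2 le_p]] := cutE X x y Sx Sy Xx Xy.
  have [btw h1 h2] := far _ _ Sp1 Sp2 Xp1 Xp2 le_p.
  have nb s : s \in S -> gate v != s by apply: contraTneq => <-.
  case: Ep => Ep; [exists p | exists (p.2, p.1)] => //; rewrite inE /= !nb //=.
    by rewrite btw h1.
  by rewrite betweenC // btw h2.
have le_sum : 3 * \sum_(p <- E) #|pair_block p.1 p.2| <= size E * c.
  rewrite big_distrr /= -sum1_size big_distrl /=; apply: leq_sum => p _.
  rewrite mul1n; apply: leq_trans (pair_capacity_le k (d p.1 p.2)).
  by rewrite leq_mul2l card_pair_block.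
have := card_gate_in; have := cardsC [set v | gate v \in S].
have -> : ~: [set v | gate v \in S] = [set v | gate v \notin S].
  by apply/setP=> v; rewrite !inE.
(* The denominator splits as the cost [3 * k.+1] of a sensor plus the cost [c] of a spanning tree
   edge; having fewer edges than sensors frees the [c] on the left. *)
rewrite -/n; have -> : k ^ 2 + 4 * k + 3 + (k == 1 %[mod 3]) = 3 * k.+1 + c.
  by rewrite /c; lia.
by rewrite mulnDr; nia.
Qed.

End Counting.

Theorem theorem1p1 (V : finType) (e : rel V) (n k : nat)
    (card_V : #|V| = n) (n_ge1 : 1 <= n) (tree_e : tree e) (k_ge1 : 1 <= k) :
  (Num.ceil ((3 * n + k ^ 2 + k + (k == 1 %[mod 3]))%N%:R
             / (k ^ 2 + 4 * k + 3 + (k == 1 %[mod 3]))%N%:R : rat)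
   <= (Tmd e k)%:Z)%R.
Proof.
have [[S resS <-] _] := TmdP e k.
have := card_tree_le tree_e resS; rewrite card_V => /(_ n_ge1) le_nat.
rewrite Num.Theory.ceil_le_int Num.Theory.ler_pdivrMr; last first.
  by rewrite Num.Theory.ltr0n; lia.
by rewrite -pmulrn -GRing.natrM Num.Theory.ler_nat; lia.
Qed.
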